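(* Let $N\geq 1$, $K\geq 0$ and $0\leq i\leq (N-1)\cdot K$ be natural numbers. (1) In terms of multisets one has $$C_{N}(K,i) \;=\; \sum_{\varphi\in\mathcal{M}[K,i](\boldsymbol{N})} (\varphi),$$ where $(\varphi)$ denotes the multiset coefficient of $\varphi$. (2) $N$-nomials are closed under reversal: $$C_{N}(K,i) \;=\; C_{N}\big(K,\,(N-1)\cdot K - i\big).$$
   Context: For $N\geq 1$ write $\boldsymbol{N}=\{0,1,\ldots,N-1\}\subseteq\mathbb{N}$. For $K\in\mathbb{N}$ and $0\leq i\leq (N-1)\cdot K$, the $N$-nomial coefficient is the natural number $$C_{N}(K,i) := \big|\{(n_1,\ldots,n_K)\in\boldsymbol{N}^{K} \mid n_1+\cdots+n_K = i\}\big|.$$ A multiset over a set $X$ is a function $\varphi\colon X\to\mathbb{N}$ with finite support. Its size is $\|\varphi\| := \sum_{x}\varphi(x)$, and $\mathcal{M}[K](X)$ is the set of multisets over $X$ of size $K$. The multiset coefficient of $\varphi$ is $$(\varphi) := \frac{\|\varphi\|!}{\prod_{x}\varphi(x)!}.$$ For $\varphi\in\mathcal{M}[K](\boldsymbol{N})$ put $\mathrm{sum}(\varphi) := \sum_{0\leq j<N}\varphi(j)\cdot j$, and let $\mathcal{M}[K,i](\boldsymbol{N}) := \{\varphi\in\mathcal{M}[K](\boldsymbol{N}) \mid \mathrm{sum}(\varphi)=i\}$. *)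

(* Defs.v *)
From mathcomp Require Import all_boot finmap multiset.
From mathcomp Require Import boolp classical_sets functions cardinality fsbigop.

Set Implicit Arguments.
Unset Strict Implicit.
Unset Printing Implicit Defensive.

Local Open Scope fset_scope.
Local Open Scope mset_scope.
Local Open Scope nat_scope.

Definition nnomial (N K i : nat) : nat :=
  #|[pred t : K.-tuple 'I_N | \sum_(k < K) tnth t k == i]|.

Definition mset_size (X : choiceType) (phi : {mset X}) : nat :=
  \sum_(x <- finsupp phi) phi x.

Definition multisets (X : choiceType) (K : nat) : set {mset X} :=
  [set phi | mset_size phi = K]%classic.

(* The truncated division is exact, see [mset_coef_dvd]. *)
Definition mset_coef (X : choiceType) (phi : {mset X}) : nat :=
  (mset_size phi)`! %/ \prod_(x <- finsupp phi) (phi x)`!.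

Definition mset_sum (N : nat) (phi : {mset 'I_N}) : nat :=
  \sum_(j < N) phi j * j.

Definition multisets_sum (N K i : nat) : set {mset 'I_N} :=
  [set phi | multisets K phi /\ mset_sum phi = i]%classic.
Arguments multisets_sum N K i : clear implicits.

Lemma mset_coef_dvd (X : choiceType) (phi : {mset X}) :
  \prod_(x <- finsupp phi) (phi x)`! %| (mset_size phi)`!.
Proof.
rewrite /mset_size; elim: (finsupp phi : seq X) => [|x s IHs].
  by rewrite !big_nil.
rewrite !big_cons -(bin_fact (leq_addr (\sum_(y <- s) phi y) (phi x))) addKn.
by rewrite dvdn_mull // dvdn_mul.
Qed.

(* [\big[addn/0]_(phi \in A) F phi] over a set [A] has the junk value 0 when
   [F] has infinite support on [A]; this lemma rules that case out. *)
Lemma finite_multisets_sum (N K i : nat) :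
  finite_set (multisets_sum N K i).
Proof.
pose g (f : {ffun 'I_N -> 'I_K.+1}) : {mset 'I_N} :=
  [fsfun x in [fset x | x : 'I_N] => f x : nat].
apply: (@sub_finite_set _ _ (g @` setT)%classic); last first.
  exact/finite_image/finite_finset.
move=> phi [phiK _]; exists [ffun x => inord (phi x)] => //.
apply/fsfunP => x; rewrite fsfunE in_fset /= ffunE inordK // ltnS -phiK.
have [xphi|/fsfun_dflt -> //] := boolP (x \in finsupp phi).
by rewrite /mset_size (big_fsetD1 x) //= leq_addr.
Qed.

(* Main.v *)
Require Import Defs.
From mathcomp Require Import all_boot finmap multiset.
From mathcomp Require Import boolp classical_sets functions cardinality fsbigop.

(** For (1), group the tuples with sum [i] by their multiset of entries. The sum depends only on
    that multiset ([sum_tnth]), so the groups are indexed by [multisets_sum N K i], and the group of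
    [phi] has [mset_coef phi] elements ([card_tuple_seq_mset]), the classical count of arrangements,
    proved by induction in [card_tuple_count_mem]. For (2), replacing each entry [j] by [N - 1 - j]
    is an involution on tuples that turns the sum [i] into [(N - 1) * K - i]. *)

Lemma card_cons_tuple (T : finType) (n : nat) (P : pred (seq T)) :
  #|[pred t : n.+1.-tuple T | P t]|
    = \sum_(x : T) #|[pred t : n.-tuple T | P (x :: t)]|.
Proof.
under eq_bigr do rewrite -sum1_card.
rewrite pair_big_dep -sum1_card /=.
rewrite (reindex (fun p : T * n.-tuple T => cons_tuple p.1 p.2)) //=.
exists (fun t : n.+1.-tuple T => (thead t, behead_tuple t)) => [[x t] _|t _] /=.
  by congr pair; apply: val_inj.
by rewrite [RHS]tuple_eta; apply: val_inj.
Qed.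

(* Induction on [n]: deleting the head [x] of a tuple turns the weight [f] into
   [g] below, and the factorials change by the factor [f x]; these factors sum
   to [n.+1]. *)
Lemma card_tuple_count_mem (T : finType) (n : nat) (f : T -> nat) :
  \sum_(x : T) f x = n ->
  #|[pred t : n.-tuple T | [forall x, count_mem x t == f x]]|
    * \prod_(x : T) (f x)`! = n`!.
Proof.
elim: n f => [|n IHn] f sumf.
  have f0 x : f x = 0 by apply/eqP; rewrite -leqn0 -sumf (bigD1 x) //= leq_addr.
  rewrite big1 => [|x _]; last by rewrite f0.
  rewrite muln1 -(eq_card (A := predT)) ?card_tuple // => t.
  by rewrite !inE tuple0 /=; apply/esym/forallP => x; rewrite f0.
rewrite (card_cons_tuple _ _ (fun s => [forall x, count_mem x s == f x])).
rewrite big_distrl /= factS -[n.+1]sumf big_distrl /=.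
(* If [f x = 0], no admissible tuple starts with [x]; this case is split off because the subtraction
   defining [g] would truncate there. *)
apply: eq_bigr => x _; have [fx0|fx_gt0] := posnP (f x).
  rewrite fx0 mul0n eq_card0 // => t; rewrite !inE.
  by apply/negP => /forallP/(_ x); rewrite /= eqxx fx0.
pose g y := f y - (x == y).
have fE y : f y = (x == y) + g y.
  by rewrite /g subnKC //; case: eqP => [<-|].
have sumg : \sum_y g y = n.
  apply/eqP; rewrite -(eqn_add2l 1) [1 + n]add1n -sumf.
  under [in eqbRHS]eq_bigr do rewrite fE.
  rewrite big_split eqn_add2r (bigD1 x) //= eqxx big1 // => y.
  by rewrite eq_sym => /negPf ->.
have prodg : \prod_y (f y)`! = f x * \prod_y (g y)`!.
  rewrite (bigD1 x) //= [in RHS](bigD1 x) //= mulnA /g eqxx subn1.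
  case: (f x) fx_gt0 => // m _; rewrite factS; congr (_ * _).
  by apply: eq_bigr => y; rewrite eq_sym => /negPf ->; rewrite subn0.
rewrite prodg mulnCA -(IHn g sumg); congr (_ * (_ * _)).
apply: eq_card => t; rewrite !inE; apply: eq_forallb => y.
by rewrite /= [in LHS]fE eqn_add2l.
Qed.

Lemma sum_tnth (n : nat) (T : finType) (f : T -> nat) (t : n.-tuple T) :
  \sum_(k < n) f (tnth t k) = \sum_(x : T) count_mem x t * f x.
Proof.
rewrite -(big_tuple _ _ t xpredT).
elim: (t : seq T) => [|y s IHs]; first by rewrite big_nil big1.
rewrite big_cons {}IHs; under [RHS]eq_bigr do rewrite /= mulnDl.
rewrite big_split [in RHS](bigD1 y) //= eqxx mul1n.
rewrite [X in _ = _ + X + _]big1 ?addn0 // => x.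
by rewrite eq_sym => /negPf ->.
Qed.

(** Passes from the support, used in [mset_size] and [mset_coef], to the whole finite type, used in
    the counting. Both cases are covered, since points off the support contribute [0] to the size
    and [0! = 1] to the product. *)
Lemma big_finsupp (R : Type) (idx : R) (op : Monoid.com_law idx) (T : finType)
    (F : T -> R) (phi : {mset T}%mset) :
  (forall x, phi x = 0 -> F x = idx) ->
  \big[op/idx]_(x <- finsupp phi) F x = \big[op/idx]_(x : T) F x.
Proof.
move=> F0; rewrite big_uniq ?fset_uniq //= big_mkcond /=.
apply: eq_bigr => x _; case: ifPn => // /fsfun_dflt phi0.
by rewrite F0.
Qed.

Lemma card_tuple_seq_mset (T : finType) (phi : {mset T}%mset) (n : nat) :
  mset_size phi = n ->
  #|[pred t : n.-tuple T | seq_mset t == phi]| = mset_coef phi.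
Proof.
move=> phin; rewrite /mset_coef phin.
move: phin; rewrite /mset_size !big_finsupp => // [phin|x -> //].
rewrite -(card_tuple_count_mem _ _ _ phin) mulnK; last first.
  by apply: prodn_gt0 => x; apply: fact_gt0.
apply: eq_card => t; rewrite !inE; apply/eqP/forallP => [<- x|tphi].
  by rewrite mset_seqE.
by apply/msetP => x; rewrite mset_seqE; apply/eqP.
Qed.

Lemma mset_size_seq_mset (T : choiceType) (s : seq T) :
  mset_size (seq_mset s) = size s.
Proof.
rewrite -(perm_size (perm_eq_seq_mset s)) -sum1_size (sum_mset _ xpredT).
by apply: eq_bigr => x _; rewrite muln1.
Qed.

Lemma nnomial_mset (N K i : nat) :
  nnomial N K i = \big[addn/0]_(phi \in multisets_sum N K i) mset_coef phi.
Proof.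
have finM := finite_multisets_sum N K i.
rewrite fsbig_finite //= /nnomial -sum1_card.
(* Double counting: the inner sum is 1, since [seq_mset t] occurs exactly once in the duplicate-free
   enumeration. *)
transitivity (\sum_(t : K.-tuple 'I_N | \sum_(k < K) tnth t k == i)
                \sum_(phi <- fset_set (multisets_sum N K i) | seq_mset t == phi) 1).
  apply: eq_bigr => t /eqP sumt.
  rewrite sum1_count (eq_count (a2 := pred1 (seq_mset t))); last first.
    by move=> phi; rewrite eq_sym.
  rewrite count_uniq_mem ?fset_uniq // in_fset_set // mem_set //.
  split; first by rewrite /multisets /= mset_size_seq_mset size_tuple.
  rewrite -sumt (sum_tnth _ _ (@nat_of_ord N)).
  by apply: eq_bigr => x _; rewrite mset_seqE.
rewrite (exchange_big_dep xpredT) //= big_seq [RHS]big_seq.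
apply: eq_bigr => phi; rewrite in_fset_set // => /set_mem[/= sizephi sumphi].
rewrite -(card_tuple_seq_mset _ _ _ sizephi) -sum1_card.
(* The condition on the sum of [t] is implied by [seq_mset t == phi], as [mset_sum phi = i]. *)
apply: eq_bigl => t; rewrite !inE andb_idl // => /eqP tphi.
rewrite (sum_tnth _ _ (@nat_of_ord N)) -sumphi -tphi.
by apply/eqP/eq_bigr => x _; rewrite mset_seqE.
Qed.

Lemma nnomial_rev (N K i : nat) : i <= (N - 1) * K ->
  nnomial N K i = nnomial N K ((N - 1) * K - i).
Proof.
move=> le_i; pose rev_tuple (t : K.-tuple 'I_N) := map_tuple (@rev_ord N) t.
have rev_tupleK : involutive rev_tuple.
  by move=> t; apply: val_inj; rewrite /= mapK //; apply: rev_ordK.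
rewrite /nnomial -!sum1_card (reindex_inj (inv_inj rev_tupleK)).
apply: eq_bigl => t; rewrite !inE.
have sum_rev : \sum_(k < K) tnth (rev_tuple t) k + \sum_(k < K) tnth t k
    = (N - 1) * K.
  rewrite -big_split /= mulnC -[K in RHS]card_ord -sum_nat_const.
  apply: eq_bigr => k _; rewrite tnth_map /= -add1n subnDA subnK //.
  by rewrite subn1 -ltnS (ltn_predK (ltn_ord (tnth t k))).
rewrite -(eqn_add2r (\sum_(k < K) tnth t k)) sum_rev.
(* Here [le_i] makes the truncated subtraction exact. *)
by rewrite -[in RHS](eqn_add2l i) subnKC // eq_sym.
Qed.

Theorem proposition1 (N K i : nat) (hN : 1 <= N) (hi : i <= (N - 1) * K) :
  nnomial N K i = \big[addn/0]_(phi \in multisets_sum N K i) mset_coef phi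
  /\ nnomial N K i = nnomial N K ((N - 1) * K - i).
Proof. by split; [apply: nnomial_mset|apply: nnomial_rev]. Qed.
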